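(* Consider the randomized exchange algorithm described in the context, with parameters $\alpha=\sqrt d/\gamma$ and $\kappa$, producing solution sets $S_0,S_1,\dots$. Suppose that $\lambda_{\min}\big(\sum_{i\in S_t}v_iv_i^\top\big)<1$ for all $t\in[\tau]$. Then, for any $\delta\in[0,1]$, \[ \Pr\Big[\,|S_\tau|\le(1+\delta)\sum_{i=1}^m x(i)+\Big(\frac{12d}{\gamma}+\frac{2d}{\kappa}\Big)\Big]\ge 1-\exp\Big(-\Omega\Big(\frac{\delta d}{\min\{\gamma,\kappa\}}\Big)\Big). \]
   Context: Inputs: $u_1,\dots,u_m\in\mathbb{R}^d$, integer budget $k\ge d$, integer $p\ge1$, $\varepsilon\in(0,1)$. For a $d\times d$ symmetric positive definite $A$, $\Phi_p(A)=(\frac1d\operatorname{tr}(A^{-p}))^{1/p}$; the convex relaxation is: minimize $\Phi_p(\sum_{i=1}^m x(i)u_iu_i^\top)$ subject to $\sum_i x(i)\le k$, $0\le x(i)\le1$. $\langle A,B\rangle=\operatorname{tr}(A^\top B)$. Randomized exchange algorithm: compute an optimal $x\in[0,1]^m$ of the relaxation with at most $d^2+1$ fractional entries; $X=\sum_ix(i)u_iu_i^\top$; $v_i=X^{-1/2}u_i$ (so $\sum_ix(i)v_iv_i^\top=I_d$); $\gamma=\max\{\varepsilon/6,1/(6p)\}$, $\kappa=\max\{\varepsilon/2,1/(2p)\}$, $M=d/\gamma+d^2+1$, $\alpha=\sqrt d/\gamma$; $S_0$ contains each $i$ independently with probability $x(i)$. For $t=1,2,\dots$: $Y_t=\sum_{i\in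 S_{t-1}}u_iu_i^\top$, $Z_t=\sum_{i\in S_{t-1}}v_iv_i^\top$; stop and return $S_{t-1}$ if $(\operatorname{tr}(Y_t^{-p}))^{1/p}\le(1+\varepsilon)(\operatorname{tr}(X^{-p}))^{1/p}$ or $t>\frac{2M}\gamma+\frac{2M}{\varepsilon p}$; otherwise: $A_t=(\alpha Z_t-c_tI)^{-2}$ with $c_t$ the unique scalar such that $\alpha Z_t-c_tI\succ0$ and $\operatorname{tr}(A_t)=1$; $S'_{t-1}=\{i\in S_{t-1}:\alpha\langle v_iv_i^\top,A_t^{1/2}\rangle\le\frac12,\ \langle v_iv_i^\top,Z_t^{-1}\rangle\le\kappa\}$; $\Pr(j_t=j)=\frac{x(j)}M(1+\alpha\langle v_jv_j^\top,A_t^{1/2}\rangle)$ for $j\in[m]\setminus S_{t-1}$, else $j_t=\emptyset$; $\Pr(i_t=i)=\frac{1-x(i)}M(1-\alpha\langle v_iv_i^\top,A_t^{1/2}\rangle)$ for $i\in S'_{t-1}$, else $i_t=\emptyset$; $S_t=(S_{t-1}\cup\{j_t\})\setminus\{i_t\}$. $\Omega(\cdot)$ hides an absolute constant. *)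

(* Defs.v *)
From HB Require Import structures.
From mathcomp Require Import all_boot all_order all_algebra.
From mathcomp Require Import all_classical all_reals all_analysis.

Set Implicit Arguments.
Unset Strict Implicit.
Unset Printing Implicit Defensive.

Import Order.TTheory GRing.Theory Num.Theory.

Local Open Scope ring_scope.

Section Matrices.
Variables (R : realType) (d : nat).
Implicit Types A B : 'M[R]_d.

Definition qform A (w : 'cV[R]_d) : R := (w^T *m A *m w) ord0 ord0.

Definition psdmx A : Prop := A^T = A /\ forall w : 'cV[R]_d, 0 <= qform A w.

Definition pdmx A : Prop :=
  A^T = A /\ forall w : 'cV[R]_d, w != 0 -> 0 < qform A w.

Definition mxdot A B : R := \tr (A^T *m B).

(* The positive semidefinite square root; it is unique when it exists, and it
   exists whenever A is positive semidefinite. *)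
Definition sqrtmx A : 'M[R]_d :=
  xget 0 [set B : 'M[R]_d | psdmx B /\ B *m B = A]%classic.

(* The smallest eigenvalue; only used on symmetric matrices, for which the set
   of eigenvalues is finite and, when 0 < d, nonempty. *)
Definition lambda_min A : R := inf [set a : R | eigenvalue A a]%classic.

Definition outer (w : 'cV[R]_d) : 'M[R]_d := w *m w^T.

(* tr (A^-p); meaningful for invertible A only. *)
Definition tr_negpow (p : nat) A : R := \tr (invmx A ^+ p).

Definition Phi (p : nat) A : R := (d%:R^-1 * tr_negpow p A) `^ (p%:R^-1).

End Matrices.

Section Relaxation.
Variables (R : realType) (d m : nat) (u : 'I_m -> 'cV[R]_d).
Implicit Types x y : 'I_m -> R.

Definition wsum x : 'M[R]_d := \sum_(i < m) x i *: outer (u i).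

(* Phi p is defined on positive definite matrices, so these are the points
   where the objective is defined (i.e. finite). *)
Definition feasible (k : nat) x : Prop :=
  [/\ \sum_(i < m) x i <= k%:R, forall i, 0 <= x i <= 1 & pdmx (wsum x)].

Definition optimal (p k : nat) x : Prop :=
  feasible k x /\ forall y, feasible k y -> Phi p (wsum x) <= Phi p (wsum y).

Definition fractional x : {set 'I_m} := [set i | 0 < x i < 1].

End Relaxation.

Section RandomizedExchange.
Variables (R : realType) (d m : nat) (u : 'I_m -> 'cV[R]_d).
Variables (p : nat) (eps : R) (x : 'I_m -> R).
Implicit Types S T : {set 'I_m}.

Definition X : 'M[R]_d := wsum u x.

Definition v (i : 'I_m) : 'cV[R]_d := sqrtmx (invmx X) *m u i.

Definition gamma : R := Num.max (eps / 6) (1 / (6 * p%:R)).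
Definition kappa : R := Num.max (eps / 2) (1 / (2 * p%:R)).
Definition bigM : R := d%:R / gamma + d%:R ^+ 2 + 1.
Definition alpha : R := Num.sqrt d%:R / gamma.

Definition Y S : 'M[R]_d := \sum_(i in S) outer (u i).
Definition Z S : 'M[R]_d := \sum_(i in S) outer (v i).

(* The objective of a singular Y S is infinite, hence the test of
   invertibility. *)
Definition stop (t : nat) S : bool :=
  ((Y S \in unitmx) &&
   (tr_negpow p (Y S) `^ (p%:R^-1) <=
      (1 + eps) * tr_negpow p X `^ (p%:R^-1)))
  || (2 * bigM / gamma + 2 * bigM / (eps * p%:R) < t%:R).

(* c_t, as a function of the current set only. *)
Definition cshift S : R :=
  xget 0 [set c : R | pdmx (alpha *: Z S - c%:M) /\
                      \tr (invmx (alpha *: Z S - c%:M) ^+ 2) = 1]%classic.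

Definition A S : 'M[R]_d := invmx (alpha *: Z S - (cshift S)%:M) ^+ 2.

(* alpha * < v_i v_i^T , A_t^(1/2) > *)
Definition awt S (i : 'I_m) : R := alpha * mxdot (outer (v i)) (sqrtmx (A S)).

(* [pinvmx (Z S)] is [invmx (Z S)] when Z S is invertible. When it is singular,
   v i still lies in its range for i \in S, so the inner product does not depend
   on the generalized inverse chosen (it is the Moore-Penrose value). *)
Definition removable S : {set 'I_m} :=
  [set i in S | (awt S i <= 1 / 2) &&
                (mxdot (outer (v i)) (pinvmx (Z S)) <= kappa)].

(* Laws of j_t and i_t given S_(t-1) = S; [None] encodes the empty choice. *)
Definition add_wt S (j : 'I_m) : R :=
  if j \notin S then x j / bigM * (1 + awt S j) else 0.

Definition rem_wt S (i : 'I_m) : R :=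
  if i \in removable S then (1 - x i) / bigM * (1 - awt S i) else 0.

Definition law (w : 'I_m -> R) (o : option 'I_m) : R :=
  if o is Some i then w i else 1 - \sum_(i < m) w i.

Definition oset (o : option 'I_m) : {set 'I_m} :=
  if o is Some i then [set i]%SET else finset.set0.

Definition exchange S (j i : option 'I_m) : {set 'I_m} :=
  (S :|: oset j) :\: oset i.

(* One exchange; j_t and i_t are sampled independently given S_(t-1). *)
Definition exchange_prob S T : R :=
  \sum_(j : option 'I_m) \sum_(i : option 'I_m | exchange S j i == T)
     law (add_wt S) j * law (rem_wt S) i.

(* Iteration t; the chain stays put once the algorithm has stopped. *)
Definition step_prob (t : nat) S T : R :=
  if stop t S then (T == S)%:R else exchange_prob S T.

Definition init_prob S : R :=
  (\prod_(i in S) x i) * \prod_(i in ~: S) (1 - x i).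

Definition traj (tau : nat) := {ffun 'I_tau.+1 -> {set 'I_m}}.

Definition at_time tau (s : traj tau) (t : nat) : {set 'I_m} := s (inord t).

Definition traj_prob tau (s : traj tau) : R :=
  init_prob (at_time s 0) *
  \prod_(t < tau) step_prob t.+1 (at_time s t) (at_time s t.+1).

Definition Pr tau (E : pred (traj tau)) : R :=
  \sum_(s : traj tau | E s) traj_prob s.

(* None of the iterations 1, ..., tau stops, i.e. S_tau is actually produced. *)
Definition produced tau (s : traj tau) : bool :=
  [forall t : 'I_tau, ~~ stop t.+1 (at_time s t)].

Definition small_lambda_min tau (s : traj tau) : bool :=
  [forall t : 'I_tau, lambda_min (Z (at_time s t.+1)) < 1].

End RandomizedExchange.

(* Main.v *)
(* Let n = sum_i x(i), M = bigM, and let P and N be M times the probabilities of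
   adding and of removing an element. On valid sets with lambda_min(Z) < 1, the
   identities sum_i x(i) v_i v_i^T = I and alpha Z = A^(-1/2) + c I with c <= alpha,
   together with tr A^(1/2) <= sqrt d and tr(Z Z^+) <= d, give
   P <= n + d/gamma  and  P - N <= n + c0 - |S|,
   c0 = 3d/gamma + 2d + d/kappa.
   Hence, with W_t = E[exp(l |S_t|)] restricted to the event of the theorem,
   W_(t+1) <= (1 - rho) W_t + rho exp(l b),
   b = n + c0 + (n + d/gamma)(e^l - 1),  rho = (1 - e^-l)/(M l) in [0,1],
   for t >= 1; since W_0 and W_1 are at most exp(l b), so is every W_t. Markov's inequality with l = delta/2, for
   which e^l - 1 <= delta, gives the tail bound with the constant 1, because
   gamma <= kappa. *)

Require Import Defs.
From HB Require Import structures.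
From mathcomp Require Import all_boot all_order all_algebra.
From mathcomp Require Import all_classical all_reals all_analysis.
From mathcomp Require complex.
From mathcomp Require Import ring lra.

Set Implicit Arguments.
Unset Strict Implicit.
Unset Printing Implicit Defensive.

Import Order.TTheory GRing.Theory Num.Theory.
Import numFieldNormedType.Exports.

Local Open Scope ring_scope.

(** * The real spectral theorem *)

Section RealSpectral.
Import complex.
Local Open Scope complex_scope.
Variable R : rcfType.

Lemma trmx_1x1 (M : 'M[R]_1) : M^T = M.
Proof. by apply/matrixP => i j; rewrite !ord1 mxE. Qed.

Lemma sqr_norm_row_eq0 n (w : 'rV[R]_n) : (w *m w^T) 0 0 <= 0 -> w = 0.
Proof.
rewrite !mxE => w0; apply/rowP => i; rewrite mxE.
have sq_ge0 j : 0 <= w 0 j * w^T j 0 by rewrite mxE -expr2 sqr_ge0.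
have /eqP : \sum_j w 0 j * w^T j 0 = 0.
  by apply/eqP; rewrite eq_le w0 sumr_ge0.
rewrite psumr_eq0 // => /allP /(_ i (mem_index_enum _)) /=.
by rewrite mxE mulf_eq0 orbb => /eqP.
Qed.

(** Split a complex eigenvector as [a + ib]. Symmetry gives [Im z * (|a|^2 + |b|^2) = 0], so the
    eigenvalue [z] is real and whichever of [a], [b] is nonzero is a real eigenvector. *)
Lemma sym_real_eigen n (A : 'M[R]_n) : (0 < n)%N -> A^T = A ->
  exists a, exists2 w : 'rV[R]_n, w *m A = a *: w & w != 0.
Proof.
move=> n0 symA.
have [z /eigenvalueP [w wE w0]] := eigenvalue_closed (map_mx (real_complex R) A) n0.
pose a := map_mx (@Re R) w; pose b := map_mx (@Im R) w.
have ReS (F : 'I_n -> R[i]) : Re (\sum_i F i) = \sum_i Re (F i).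
  by apply: (big_morph (@Re R)) => // -[? ?] [].
have ImS (F : 'I_n -> R[i]) : Im (\sum_i F i) = \sum_i Im (F i).
  by apply: (big_morph (@Im R)) => // -[? ?] [].
have aE : a *m A = Re z *: a - Im z *: b.
  apply/rowP => i; move/rowP: wE => /(_ i) /(congr1 (@Re R)).
  rewrite !mxE ReS => wE; transitivity (Re (z * w 0 i)); last first.
    by case: (z) (w 0 i) => ? ? [].
  rewrite -wE.
  by apply: eq_bigr => j _; rewrite !mxE; case: (w 0 j) => x y /=; ring.
have bE : b *m A = Re z *: b + Im z *: a.
  apply/rowP => i; move/rowP: wE => /(_ i) /(congr1 (@Im R)).
  rewrite !mxE ImS => wE; transitivity (Im (z * w 0 i)); last first.
    by case: (z) (w 0 i) => ? ? [].
  rewrite -wE.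
  by apply: eq_bigr => j _; rewrite !mxE; case: (w 0 j) => x y /=; ring.
have [a0 b0] : 0 <= (a *m a^T) 0 0 /\ 0 <= (b *m b^T) 0 0.
  by split; rewrite mxE sumr_ge0 // => i _; rewrite [_^T _ _]mxE -expr2 sqr_ge0.
have ab_sym : (a *m b^T) 0 0 = (b *m a^T) 0 0.
  by rewrite -[a *m _]trmx_1x1 trmx_mul trmxK.
have tE : Im z * ((a *m a^T) 0 0 + (b *m b^T) 0 0) = 0.
  have : (a *m A *m b^T) 0 0 = (b *m A *m a^T) 0 0.
    by rewrite -[a *m _ *m _]trmx_1x1 !trmx_mul trmxK symA mulmxA.
  rewrite aE bE mulmxBl mulmxDl -!scalemxAl !mxE => H.
  move: ab_sym; rewrite !mxE => ab_sym; move: H; rewrite ab_sym; lra.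
move/eqP: tE; rewrite mulf_eq0 => /orP[/eqP t0|/eqP ab0]; last first.
  have /sqr_norm_row_eq0 a1 : (a *m a^T) 0 0 <= 0 by lra.
  have /sqr_norm_row_eq0 b1 : (b *m b^T) 0 0 <= 0 by lra.
  case/eqP: w0; apply/rowP => i; move/rowP: a1 => /(_ i); move/rowP: b1 => /(_ i).
  by rewrite !mxE; case: (w 0 i) => x y /= -> ->.
rewrite t0 scale0r subr0 in aE; rewrite t0 scale0r addr0 in bE.
exists (Re z); have [a1|] := eqVneq a 0; last by exists a.
exists b => //; apply: contra_neq w0 => b1.
apply/rowP => i; move/rowP: a1 => /(_ i); move/rowP: b1 => /(_ i).
by rewrite !mxE; case: (w 0 i) => x y /= -> ->.
Qed.

(* H is the Householder reflection along [e - w]. *)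
Lemma reflection_exists n (w e : 'rV[R]_n) : w *m w^T = 1%:M -> e *m e^T = 1%:M ->
  exists H : 'M[R]_n, [/\ H^T = H, H *m H = 1%:M & e *m H = w].
Proof.
move=> ww ee; pose f := e - w.
have we : w *m e^T = e *m w^T.
  by rewrite -[LHS]trmx_1x1 trmx_mul trmxK.
pose s := (e *m w^T) 0 0; have sE : e *m w^T = s%:M.
  by apply/matrixP => i j; rewrite !ord1 [RHS]mxE eqxx mulr1n.
have ffT : f *m f^T = (2 - 2 * s)%:M.
  rewrite linearB mulmxBl !mulmxBr ww ee we sE.
  by apply/matrixP => i j; rewrite !ord1 !mxE eqxx /=; ring.
have efT : e *m f^T = (1 - s)%:M.
  rewrite linearB mulmxBr ee sE.
  by apply/matrixP => i j; rewrite !ord1 !mxE eqxx /=; ring.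
have [f0|f0] := eqVneq f 0.
  exists 1%:M; split; rewrite ?trmx1 ?mulmx1 //.
  by apply/eqP; rewrite -subr_eq0 -/f f0.
have s1 : 1 - s != 0.
  apply: contra_neq f0 => s1; apply: sqr_norm_row_eq0; rewrite ffT mxE /=; lra.
exists (1%:M - (1 - s)^-1 *: (f^T *m f)); split.
- by rewrite linearB linearZ /= trmx1 trmx_mul trmxK.
- set F := f^T *m f; have FF : F *m F = (2 - 2 * s) *: F.
    rewrite mulmxA -[f^T *m f *m f^T]mulmxA ffT mul_mx_scalar -scalemxAl //.
  rewrite mulmxBl !mul1mx -scalemxAl mulmxBr mulmx1 -scalemxAr FF !scalerA.
  move: F {FF} => F; apply/matrixP => i j; rewrite !mxE; field; exact: s1.
- rewrite mulmxBr mulmx1 -scalemxAr mulmxA efT mul_scalar_mx scalerA mulVf //.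
  by rewrite scale1r /f subKr.
Qed.

(** Induction on the dimension: conjugating by a reflection that exchanges the first basis vector
    and a unit eigenvector splits off a 1 x 1 block. *)
Theorem real_spectral n (A : 'M[R]_n) : A^T = A ->
  exists P : 'M[R]_n, exists D : 'rV[R]_n,
    P *m P^T = 1%:M /\ A = P^T *m diag_mx D *m P.
Proof.
elim: n A => [|n IH] A symA.
  by exists 1%:M, 0; split; apply/matrixP => -[].
have [a [w wA w0]] := sym_real_eigen (ltn0Sn n) symA.
wlog ww : w wA w0 / w *m w^T = 1%:M.
  move=> wlg; have nw : 0 < (w *m w^T) 0 0.
    rewrite lt_neqAle eq_sym; apply/andP; split.
      by apply: contra_neq w0 => nw; apply: sqr_norm_row_eq0; rewrite nw.
    by rewrite mxE sumr_ge0 // => i _; rewrite [_^T _ _]mxE -expr2 sqr_ge0.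
  pose r := Num.sqrt ((w *m w^T) 0 0).
  have r0 : r != 0 by rewrite gt_eqF // sqrtr_gt0.
  apply: (wlg (r^-1 *: w)).
  - by rewrite -scalemxAl wA !scalerA mulrC.
  - by rewrite scaler_eq0 invr_eq0 negb_or r0.
  - rewrite linearZ /= -scalemxAl -scalemxAr scalerA.
    apply/matrixP => i j; rewrite !ord1 mxE -expr2 exprVn sqr_sqrtr ?ltW //.
    by rewrite mulVf ?gt_eqF // mxE.
pose e : 'rV[R]_(1 + n) := row_mx 1%:M 0.
have ee : e *m e^T = 1%:M by rewrite tr_row_mx mul_row_col trmx0 mulmx0 addr0 trmx1 mulmx1.
have [H [symH HH eH]] := reflection_exists ww ee.
pose B : 'M[R]_(1 + n) := H *m A *m H.
have symB : B^T = B by rewrite !trmx_mul symH symA mulmxA.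
have eB : e *m B = a *: e.
  by rewrite !mulmxA eH wA -scalemxAl -eH -mulmxA HH mulmx1.
have [ulB urB] : ulsubmx B = a%:M /\ ursubmx B = 0.
  move: eB; rewrite -[B]submxK mul_row_block !mul1mx !mul0mx !addr0 scale_row_mx.
  rewrite scaler0 scalemx1 => /eq_row_mx [? ?].
  by rewrite block_mxKul block_mxKur.
have dlB : dlsubmx B = 0 by rewrite -symB -trmx_ursub urB trmx0.
have [P [D [PP DE]]] := IH (drsubmx B) (etrans (trmx_drsub _) (congr1 drsubmx symB)).
pose Q : 'M[R]_(1 + n) := block_mx 1%:M 0 0 P.
have QT : Q^T = block_mx 1%:M 0 0 P^T by rewrite /Q tr_block_mx trmx1 !trmx0.
have QQ : Q *m Q^T = 1%:M.
  rewrite QT mulmx_block !(mulmx0, mul0mx, mulmx1, mul1mx, addr0, add0r) PP.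
  by rewrite -scalar_mx_block.
have BE : B = Q^T *m diag_mx (row_mx a%:M D) *m Q.
  rewrite -[LHS]submxK ulB urB dlB DE diag_mx_row QT.
  rewrite !mulmx_block !(mulmx0, mul0mx, mulmx1, mul1mx, addr0, add0r).
  congr block_mx.
  by apply/matrixP => i j; rewrite !mxE !ord1 eqxx.
exists (Q *m H), (row_mx a%:M D); split.
  by rewrite trmx_mul symH mulmxA -[Q *m H *m H]mulmxA HH mulmx1.
have -> : A = H *m B *m H by rewrite /B !mulmxA HH mul1mx -mulmxA HH mulmx1.
by rewrite BE trmx_mul symH !mulmxA.
Qed.
End RealSpectral.

(** * Positive semidefinite matrices *)

Section PositiveSemidefinite.
Variables (R : realType) (d : nat).
Implicit Types A B Q : 'M[R]_d.

Lemma qform_outer (w z : 'cV[R]_d) : qform (outer w) z = (w^T *m z) 0 0 ^+ 2.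
Proof.
rewrite /qform /outer -!mulmxA mulmxA mxE big_ord1 expr2; congr (_ * _).
by rewrite -[z^T *m w]trmx_1x1 trmx_mul trmxK.
Qed.

Lemma qformD A B w : qform (A + B) w = qform A w + qform B w.
Proof. by rewrite /qform mulmxDr mulmxDl mxE. Qed.

Lemma qform_sum I (r : seq I) (P : pred I) (F : I -> 'M[R]_d) w :
  qform (\sum_(i <- r | P i) F i) w = \sum_(i <- r | P i) qform (F i) w.
Proof. by rewrite /qform mulmx_sumr mulmx_suml summxE. Qed.

Lemma mxdot_outer (w : 'cV[R]_d) A : mxdot (outer w) A = qform A w.
Proof.
rewrite /mxdot /outer trmx_mul trmxK mxtrace_mulC mulmxA mxtrace_mulC.
by rewrite trace_mx11 mulmxA.
Qed.

Lemma pdmx_psd A : pdmx A -> psdmx A.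
Proof.
case=> symA pA; split=> // w; have [->|/pA /ltW //] := eqVneq w 0.
by rewrite /qform mulmx0 mxE.
Qed.

Lemma pdmxDr A B : psdmx A -> pdmx B -> pdmx (A + B).
Proof.
move=> [sA pA] [sB pB]; split=> [|w w0]; first by rewrite linearD /= sA sB.
by rewrite qformD ltr_wpDl ?pB.
Qed.

Lemma pdmx_unit A : pdmx A -> A \in unitmx.
Proof.
move=> [symA pA]; rewrite -row_free_unit; apply: inj_row_free => w wA.
apply/eqP; apply: contraT => w0.
have /pA : w^T != 0 by apply: contra_neq w0 => w0; rewrite -[w]trmxK w0 trmx0.
by rewrite /qform trmxK wA mul0mx mxE ltxx.
Qed.

Lemma pdmx_inv A : pdmx A -> pdmx (invmx A).
Proof.
move=> pdA; have uA := pdmx_unit pdA; have [symA pA] := pdA.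
have symV : (invmx A)^T = invmx A by rewrite trmx_inv symA.
split=> // w w0; have -> : qform (invmx A) w = qform A (invmx A *m w).
  by rewrite /qform trmx_mul symV !mulmxA mulmxKV.
by apply: pA; apply: contra_neq w0 => w0; rewrite -[w](mulKVmx uA) w0 mulmx0.
Qed.

Lemma psdmx_sqr A : A^T = A -> psdmx (A *m A).
Proof.
move=> symA; split; first by rewrite trmx_mul symA.
move=> w; rewrite /qform mulmxA -mulmxA -{1}symA -trmx_mul mxE sumr_ge0 // => i _.
by rewrite [_^T _ _]mxE -expr2 sqr_ge0.
Qed.

Lemma qform_delta A i : qform A (delta_mx i 0) = A i i.
Proof. by rewrite /qform trmx_delta -rowE -colE !mxE. Qed.

Lemma psdmx_tr_ge0 A : psdmx A -> 0 <= \tr A.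
Proof.
by move=> [_ pA]; apply: sumr_ge0 => i _; rewrite -qform_delta pA.
Qed.

Lemma psdmx_sqrt A : psdmx A -> psdmx (sqrtmx A) /\ sqrtmx A *m sqrtmx A = A.
Proof.
move=> [symA pA]; apply: (@xgetPex _ 0 [set B | psdmx B /\ B *m B = A]%classic).
have [P [D [PP AE]]] := real_spectral symA.
have D0 i : 0 <= D 0 i.
  have := pA (P^T *m delta_mx i 0); rewrite /qform AE trmx_mul trmxK !mulmxA.
  rewrite -[_ *m P *m P^T]mulmxA PP mulmx1 -[_ *m P *m P^T]mulmxA PP mulmx1.
  by rewrite -/(qform (diag_mx D) (delta_mx i 0)) qform_delta mxE eqxx mulr1n.
(* Fourth roots of the eigenvalues, so that the square root [B *m B] is visibly positive
   semidefinite. *)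
pose E := map_mx (fun a : R => Num.sqrt (Num.sqrt a)) D.
pose B := P^T *m diag_mx E *m P.
have symB : B^T = B by rewrite /B !trmx_mul trmxK tr_diag_mx mulmxA.
have conjM F G : P^T *m diag_mx F *m P *m (P^T *m diag_mx G *m P) =
    P^T *m diag_mx (\row_i (F 0 i * G 0 i)) *m P.
  rewrite !mulmxA -[_ *m P *m P^T]mulmxA PP mulmx1; congr (_ *m _).
  by rewrite -mulmxA mulmx_diag.
exists (B *m B); split; first exact: psdmx_sqr.
rewrite /B !conjM AE; congr (_ *m diag_mx _ *m _); apply/rowP => i.
by rewrite !mxE -expr2 -expr2 !sqr_sqrtr ?sqrtr_ge0 // -?expr2 ?sqr_sqrtr.
Qed.

(* With [D = Q - B], squaring gives [(Q + B) D + D (Q + B) = 0], so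
   [tr (D (Q + B) D) = 0] although [Q + B] is positive definite. *)
Lemma psd_sqr_inj Q B : psdmx Q -> pdmx B -> Q *m Q = B *m B -> Q = B.
Proof.
move=> psQ pdB QB; pose D := Q - B; pose C := Q + B.
have [symC pC] : pdmx C by exact: pdmxDr.
have symD : D^T = D by rewrite /D linearB /= psQ.1 pdB.1.
have CD : C *m D + D *m C = 0.
  rewrite /C /D !(mulmxDr, mulmxDl, mulmxN, mulNmx) QB.
  move: (B *m B) (Q *m B) (B *m Q) => U V W.
  by apply/matrixP => i j; rewrite !mxE; ring.
have trD : \tr (D *m C *m D) = 0.
  have : \tr (D *m (C *m D + D *m C)) = 0 by rewrite CD mulmx0 mxtrace0.
  rewrite mulmxDr mxtraceD mulmxA [in X in _ + X]mxtrace_mulC.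
  by move=> H; lra.
apply/eqP; rewrite -subr_eq0 -/D; apply/eqP/matrixP => i j; rewrite [RHS]mxE.
have qE k : (D *m C *m D) k k = qform C (col k D).
  rewrite /qform tr_col symD -row_mul [LHS]mxE [RHS]mxE.
  by apply: eq_bigr => l _; rewrite [row _ _ _ _]mxE [col _ _ _ _]mxE.
have q0 k : true -> 0 <= (D *m C *m D) k k.
  by rewrite qE => _; have [_ ->] := pdmx_psd (conj symC pC).
have /(_ j isT) := psumr_eq0P q0 trD; rewrite qE => qj.
have [/colP /(_ i)|/pC] := eqVneq (col j D) 0; first by rewrite !mxE.
by rewrite qj ltxx.
Qed.

Lemma sqrtmx_sqr B : pdmx B -> sqrtmx (B *m B) = B.
Proof.
move=> pdB; have [psQ QQ] := psdmx_sqrt (psdmx_sqr pdB.1).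
exact: psd_sqr_inj.
Qed.

(** Cauchy-Schwarz for [Q] and the identity, read off from [tr ((I - r Q)^2) >= 0] with
    [r = sqrt d]. *)
Lemma psd_tr_le Q : (0 < d)%N -> Q^T = Q -> \tr (Q *m Q) = 1 ->
  \tr Q <= Num.sqrt d%:R.
Proof.
move=> d0 symQ trQ; set r : R := Num.sqrt d%:R.
have r0 : 0 < r by rewrite sqrtr_gt0 ltr0n.
have rr : r * r = d%:R by rewrite -expr2 sqr_sqrtr ?ler0n.
have : 0 <= \tr ((1%:M - r *: Q) *m (1%:M - r *: Q)).
  by apply/psdmx_tr_ge0/psdmx_sqr; rewrite linearB /= trmx1 linearZ /= symQ.
rewrite mulmxBl !mulmxBr !mul1mx mulmx1 -scalemxAl -scalemxAr.
rewrite !raddfB /= mxtrace1 !mxtraceZ trQ mulr1 rr => H.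
by rewrite -(ler_pM2l r0) rr; lra.
Qed.

(** By cyclicity the trace is that of [pid_mx (\rank A)], a diagonal matrix of zeros and ones. *)
Lemma tr_mul_pinvmx A : \tr (A *m pinvmx A) <= d%:R.
Proof.
rewrite -{1}(mulmx_ebase A) /pinvmx -!mulmxA.
rewrite (mulmxA (row_ebase A)) mulmxV ?row_ebase_unit // mul1mx.
rewrite (mulmxA (pid_mx _)) mxtrace_mulC mulmxKV ?col_ebase_unit //.
rewrite pid_mx_id ?rank_leq_row // /mxtrace -[d in d%:R]card_ord -sumr_const.
by apply: ler_sum => i _; rewrite !mxE eqxx; case: (_ < _)%N.
Qed.

End PositiveSemidefinite.

(** * Existence of the shift *)

(** Intermediate value theorem between [D k - r] and [D k - 1], where [D k] is the minimum and
    [r = sqrt n]: at the left end every term is at most [1/n], at the right end the term of [k] is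
    already 1. *)
Lemma inv_sqr_shift_exists (R : realType) n (D : 'I_n -> R) : (0 < n)%N ->
  exists c, (forall i, c < D i) /\ \sum_i (D i - c)^-1 ^+ 2 = 1.
Proof.
move=> n0; pose i0 := Ordinal n0.
have [k kmin] : exists k, forall i, D k <= D i.
  by case: (arg_minP D (isT : xpredT i0)) => k _ H; exists k => i; exact: H.
set r : R := Num.sqrt n%:R; pose f c := \sum_i (D i - c)^-1 ^+ 2.
have n1 : 1 <= n%:R :> R by rewrite ler1n.
have r1 : 1 <= r by rewrite -[1]sqrtr1 ler_sqrt // ltr0n.
have rr : r ^+ 2 = n%:R by rewrite sqr_sqrtr ?ler0n.
have le_ab : D k - r <= D k - 1 by lra.
have gap c i : c \in `[D k - r, D k - 1] -> 1 <= D i - c.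
  by rewrite in_itv /= => /andP[_ c1]; have := kmin i; lra.
have fcont : {within `[D k - r, D k - 1], continuous f}%classic.
  apply: continuous_in_subspaceT => c; rewrite inE /= => cab.
  rewrite /f /continuous_at.
  apply: (@cvg_big R _ +%R 0 xpredT add_continuous) => i _.
  have inv_cvg : ((D i - y)^-1 @[y --> c] --> (D i - c)^-1)%classic.
    apply: cvgV; first by rewrite gt_eqF // (lt_le_trans ltr01) // gap.
    by apply: cvgB; [exact: cvg_cst | exact: cvg_id].
  by rewrite expr2; apply: cvgM.
have fa : f (D k - r) <= 1.
  have -> : 1 = \sum_(i < n) n%:R^-1 :> R.
    by rewrite sumr_const card_ord -[RHS]mulr_natr mulVf // gt_eqF // ltr0n.
  apply: ler_sum => i _; have ri : r <= D i - (D k - r) by have := kmin i; lra.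
  have r0 : 0 < r by lra.
  rewrite exprVn lef_pV2 ?posrE ?ltr0n ?exprn_gt0 ?(lt_le_trans r0) // -rr.
  by rewrite lerXn2r // nnegrE ltW // (lt_le_trans r0).
have fb : 1 <= f (D k - 1).
  rewrite /f (bigD1 k) //=; have -> : D k - (D k - 1) = 1 by lra.
  by rewrite invr1 expr1n lerDl sumr_ge0 // => i _; rewrite sqr_ge0.
have [|c cab fc] := IVT (v := 1) le_ab fcont.
  by rewrite ge_min le_max fa fb orbT.
by exists c; split=> // i; have := gap c i cab; lra.
Qed.

(** In an orthonormal eigenbasis both conditions involve only the eigenvalues of [K], which reduces
    them to the scalar case. *)
Lemma shift_exists (R : realType) d (K : 'M[R]_d) : (0 < d)%N -> K^T = K ->
  exists c, pdmx (K - c%:M) /\ \tr (invmx (K - c%:M) ^+ 2) = 1.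
Proof.
move=> d0 symK; have [P [D [PP KE]]] := real_spectral symK.
have [c [cD c1]] := inv_sqr_shift_exists (fun i => D 0 i) d0.
have PTP : P^T *m P = 1%:M by exact: mulmx1C.
have conjM F G : P^T *m diag_mx F *m P *m (P^T *m diag_mx G *m P) =
    P^T *m diag_mx (\row_i (F 0 i * G 0 i)) *m P.
  rewrite !mulmxA -[_ *m P *m P^T]mulmxA PP mulmx1; congr (_ *m _).
  by rewrite -mulmxA mulmx_diag.
pose E := \row_i (D 0 i - c); pose E' := \row_i (D 0 i - c)^-1.
have KcE : K - c%:M = P^T *m diag_mx E *m P.
  have -> : diag_mx E = diag_mx D - c%:M.
    by apply/matrixP => i j; rewrite !mxE mulrnBl.
  by rewrite mulmxBr mulmxBl -KE mul_mx_scalar -scalemxAl PTP scalemx1.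
have E1 : P^T *m diag_mx E' *m P *m (K - c%:M) = 1%:M.
  rewrite KcE conjM -PTP; congr (_ *m _); rewrite -[RHS]mulmx1; congr (_ *m _).
  by apply/matrixP => i j; rewrite !mxE mulVf // gt_eqF // subr_gt0.
have [_ Ku] := mulmx1_unit E1.
exists c; split; last first.
  have -> : invmx (K - c%:M) = P^T *m diag_mx E' *m P.
    by rewrite -[RHS](mulmxK Ku) E1 mul1mx.
  rewrite expr2 -[_ * _]/(_ *m _) conjM mxtrace_mulC mulmxA PP mul1mx mxtrace_diag.
  by rewrite -c1; apply: eq_bigr => i _; rewrite !mxE expr2.
split; first by rewrite KcE !trmx_mul trmxK tr_diag_mx mulmxA.
move=> w w0; have -> : qform (K - c%:M) w = \sum_i E 0 i * (P *m w) i 0 ^+ 2.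
  rewrite /qform KcE !mulmxA -trmx_mul -mulmxA mxE; apply: eq_bigr => i _.
  by rewrite mul_mx_diag !mxE; ring.
rewrite lt_neqAle eq_sym; apply/andP; split; last first.
  by apply: sumr_ge0 => i _; rewrite mulr_ge0 ?sqr_ge0 // mxE subr_ge0 ltW.
have E_gt0 i : 0 < E 0 i by rewrite mxE subr_gt0.
apply: contra_neq w0 => q0.
have Pw : P *m w = 0.
  apply/colP => i; rewrite [RHS]mxE; apply/eqP.
  have /(_ i isT) /eqP := psumr_eq0P (fun j _ => mulr_ge0 (ltW (E_gt0 j)) (sqr_ge0 _)) q0.
  by rewrite mulf_eq0 sqrf_eq0 gt_eqF.
by rewrite -[w]mul1mx -PTP -mulmxA Pw mulmx0.
Qed.

(** * Sums over trajectories *)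

Section PathSums.
Variables (R : comNzRingType) (T : finType) (f : T -> R) (K : nat -> T -> T -> R).

(** The kernel may lose mass: the recursion is used both for the true chain and for its killed
    version. *)
Fixpoint path_law (t : nat) (y : T) : R :=
  if t is s.+1 then \sum_z path_law s z * K s z y else f y.

(** Induction that peels off the last state: summing over it turns [h] into the test function
    [z -> \sum_y K tau z y * h y], to which the induction hypothesis applies. *)
Lemma sum_paths (tau : nat) (h : T -> R) :
  \sum_(s : {ffun 'I_tau.+1 -> T})
     f (s (inord 0)) * (\prod_(t < tau) K t (s (inord t)) (s (inord t.+1)))
       * h (s (inord tau)) =
  \sum_y path_law tau y * h y.
Proof.
elim: tau h => [|tau IH] h.
  pose c (y : T) : {ffun 'I_1 -> T} := [ffun=> y].
  rewrite (reindex_onto c (fun s => s ord0)) /=; last first.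
    by move=> s _; apply/ffunP => i; rewrite ffunE [i]ord1.
  apply: eq_big => [y|y _]; first by rewrite ffunE eqxx.
  by rewrite big_ord0 mulr1 !ffunE.
pose ext (q : {ffun 'I_tau.+1 -> T} * T) : {ffun 'I_tau.+2 -> T} :=
  [ffun i : 'I_tau.+2 => if (i < tau.+1)%N then q.1 (inord i) else q.2].
pose restr (s : {ffun 'I_tau.+2 -> T}) :=
  ([ffun i : 'I_tau.+1 => s (inord i)], s (inord tau.+1)).
have extE q t : (t < tau.+1)%N -> ext q (inord t) = q.1 (inord t).
  by move=> lt; rewrite ffunE inordK ?lt // ltnW.
have extL q : ext q (inord tau.+1) = q.2 by rewrite ffunE inordK ?ltnn.
rewrite (reindex_onto ext restr) /=; last first.
  move=> s _; apply/ffunP => i; rewrite ffunE /=; case: ltnP => lt.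
    by rewrite ffunE inordK // inord_val.
  congr (s _); apply: val_inj; rewrite /= inordK //.
  by apply/eqP; rewrite eqn_leq lt -ltnS ltn_ord.
under eq_bigl => q.
  have -> : restr (ext q) == q.
    case: q => r y; apply/eqP; rewrite /restr extL; congr pair.
    by apply/ffunP => i; rewrite ffunE extE // inord_val.
  over.
transitivity (\sum_(r : {ffun 'I_tau.+1 -> T}) \sum_(y : T)
   f (r (inord 0)) * (\prod_(t < tau) K t (r (inord t)) (r (inord t.+1)))
     * (K tau (r (inord tau)) y * h y)).
  rewrite pair_big; apply: eq_bigr => -[r y] _ /=.
  rewrite extL big_ord_recr /= extL !extE //= -!mulrA; congr (_ * (_ * _)).
  by apply: eq_bigr => t _; rewrite !extE ?ltnS ?ltn_ord // ltnW.
transitivity (\sum_(r : {ffun 'I_tau.+1 -> T})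
   f (r (inord 0)) * (\prod_(t < tau) K t (r (inord t)) (r (inord t.+1)))
     * (\sum_y K tau (r (inord tau)) y * h y)).
  by apply: eq_bigr => r _; rewrite mulr_sumr.
rewrite (IH (fun z => \sum_y K tau z y * h y)).
transitivity (\sum_z \sum_y path_law tau z * (K tau z y * h y)).
  by apply: eq_bigr => z _; rewrite mulr_sumr.
rewrite exchange_big /=; apply: eq_bigr => y _.
by rewrite mulr_suml; apply: eq_bigr => z _; rewrite mulrA.
Qed.

Lemma path_law_mass : (forall t z, \sum_y K t z y = 1) ->
  forall t, \sum_y path_law t y = \sum_y f y.
Proof.
move=> K1; elim=> // t <-; rewrite exchange_big; apply: eq_bigr => z _ /=.
by rewrite -mulr_sumr K1 mulr1.
Qed.

End PathSums.

(** * Laws of an optional choice *)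

Lemma big_option (R : nmodType) (I : finType) (F : option I -> R) :
  \sum_o F o = F None + \sum_i F (Some i).
Proof.
rewrite (bigD1 None) //=; congr (_ + _).
rewrite (reindex_omap Some id) /=; last by case.
by apply: eq_bigl => i; rewrite eqxx.
Qed.

Section Laws.
Variables (R : realType) (m : nat) (w : 'I_m -> R).
Hypotheses (w_ge0 : forall i, 0 <= w i) (w_le1 : \sum_i w i <= 1).

Lemma law_ge0 o : 0 <= law w o.
Proof. by case: o => [i|] /=; rewrite ?subr_ge0. Qed.

(** In the exponential moments a nonempty choice contributes the factor [b = expR lam] or
    [expR (- lam)], an empty one [c = 1]. *)
Lemma sum_law_cond (b c : R) :
  \sum_o law w o * (if o is Some _ then b else c) =
  c + (\sum_i w i) * (b - c).
Proof. by rewrite big_option /= -mulr_suml; ring. Qed.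

Lemma sum_law : \sum_o law w o = 1.
Proof. by rewrite big_option /= subrK. Qed.

End Laws.

(** * The exchange chain *)

Section RandomizedExchange.
Variables (R : realType) (d m : nat) (u : 'I_m -> 'cV[R]_d).
Variables (p : nat) (eps : R) (x : 'I_m -> R).
Hypotheses (d_gt0 : (0 < d)%N) (p_gt0 : (1 <= p)%N) (eps01 : 0 < eps < 1).
Hypothesis x01 : forall i, 0 <= x i <= 1.
Hypothesis pdX : pdmx (wsum u x).
Hypothesis few_fractional : (#|fractional x| <= d ^ 2 + 1)%N.
Implicit Types S T : {set 'I_m}.

Local Notation g := (gamma p eps).
Local Notation kap := (kappa p eps).
Local Notation M := (bigM d p eps).
Local Notation a := (awt u p eps x).
Local Notation addw := (add_wt u p eps x).
Local Notation remw := (rem_wt u p eps x).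

(** * Elementary bounds on the parameters *)

Lemma gamma_gt0 : 0 < g.
Proof. by rewrite lt_max divr_gt0 //; case/andP: eps01. Qed.

Lemma gamma_le1 : g <= 1.
Proof.
have p1 : 1 <= p%:R :> R by rewrite ler1n.
rewrite ge_max; apply/andP; split; first by case/andP: eps01; lra.
by rewrite ler_pdivrMr; lra.
Qed.

Lemma gamma_le_kappa : g <= kap.
Proof.
have p1 : 1 <= p%:R :> R by rewrite ler1n.
rewrite /gamma /kappa ge_max !le_max; apply/andP; split; apply/orP.
  by left; case/andP: eps01; lra.
right; rewrite !mul1r lef_pV2 ?posrE; lra.
Qed.

Lemma kappa_gt0 : 0 < kap.
Proof. exact: lt_le_trans gamma_gt0 gamma_le_kappa. Qed.

Lemma bigM_ge1 : 1 <= M.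
Proof.
by rewrite lerDr addr_ge0 ?divr_ge0 ?exprn_ge0 ?ler0n ?(ltW gamma_gt0).
Qed.

Lemma bigM_gt0 : 0 < M.
Proof. exact: lt_le_trans ltr01 bigM_ge1. Qed.

Lemma alpha_ge0 : 0 <= alpha d p eps.
Proof. by rewrite divr_ge0 ?sqrtr_ge0 ?(ltW gamma_gt0). Qed.

Lemma alpha_sqrt : alpha d p eps * Num.sqrt d%:R = d%:R / g.
Proof. by rewrite mulrAC -expr2 sqr_sqrtr ?ler0n. Qed.

(** * Isotropy, the shifted matrix and the weights *)

(** The sum is [B X B] with [B = X^(-1/2)]. From [B (B X) = I], exchanging the factors of a square
    inverse pair gives [B X B = I]. *)
Lemma wsum_v : \sum_i x i *: outer (v u x i) = 1%:M.
Proof.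
have pdV := pdmx_inv pdX; set B := sqrtmx (invmx (X u x)).
have [[symB _] BB] := psdmx_sqrt (pdmx_psd pdV); rewrite -/(X u x) -/B in symB BB.
have -> : \sum_i x i *: outer (v u x i) = B *m X u x *m B.
  rewrite mulmx_sumr mulmx_suml; apply: eq_bigr => i _.
  by rewrite -scalemxAr -scalemxAl /outer trmx_mul symB !mulmxA.
have uX : X u x \in unitmx by exact: pdmx_unit.
have BBX : B *m (B *m X u x) = 1%:M by rewrite mulmxA BB mulVmx.
exact: mulmx1C BBX.
Qed.

(** This is [A^(-1/2)], by [sqrtmx_A] below. *)
Definition shifted S := alpha d p eps *: Z u x S - (cshift u p eps x S)%:M.

Lemma trmx_Z S : (Z u x S)^T = Z u x S.
Proof.
by rewrite linear_sum; apply: eq_bigr => i _; rewrite /outer /= trmx_mul trmxK.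
Qed.

(** Since a suitable shift exists, [cshift] never falls back on its default value 0. *)
Lemma shifted_spec S : pdmx (shifted S) /\ \tr (invmx (shifted S) ^+ 2) = 1.
Proof.
apply: (@xgetPex _ 0 [set c : R | pdmx (alpha d p eps *: Z u x S - c%:M) /\
  \tr (invmx (alpha d p eps *: Z u x S - c%:M) ^+ 2) = 1]%classic).
by apply: shift_exists => //; rewrite linearZ /= trmx_Z.
Qed.

Lemma sqrtmx_A S : sqrtmx (A u p eps x S) = invmx (shifted S).
Proof.
by rewrite /A expr2; apply/sqrtmx_sqr/pdmx_inv; case: (shifted_spec S).
Qed.

Lemma tr_inv_shifted S : 0 <= \tr (invmx (shifted S)) <= Num.sqrt d%:R.
Proof.
have [pdK trK] := shifted_spec S; have pdI := pdmx_inv pdK.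
rewrite psdmx_tr_ge0; last exact: pdmx_psd.
by apply: psd_tr_le => //; exact: pdI.1.
Qed.

Lemma awtE S i : a S i = alpha d p eps * qform (invmx (shifted S)) (v u x i).
Proof. by rewrite /awt sqrtmx_A mxdot_outer. Qed.

Lemma awt_ge0 S i : 0 <= a S i.
Proof.
rewrite awtE mulr_ge0 ?alpha_ge0 //.
by case: (shifted_spec S) => /pdmx_inv /pdmx_psd [_ ->].
Qed.

(** By isotropy the sum is [alpha * tr A^(1/2)], at most [alpha * sqrt d = d / gamma]. *)
Lemma sum_x_awt S : \sum_i x i * a S i <= d%:R / g.
Proof.
have -> : \sum_i x i * a S i = alpha d p eps * \tr (invmx (shifted S)).
  rewrite -[invmx _ in RHS]mul1mx -wsum_v mulmx_suml raddf_sum /= mulr_sumr.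
  apply: eq_bigr => i _; rewrite awtE -mxdot_outer /mxdot /outer trmx_mul trmxK.
  by rewrite -scalemxAl mxtraceZ mulrCA.
rewrite -alpha_sqrt ler_wpM2l ?alpha_ge0 //.
by case/andP: (tr_inv_shifted S).
Qed.

(* An eigenvector of Z for an eigenvalue e < 1 tests [alpha Z - c I > 0],
   giving c < alpha e. *)
Lemma cshift_le S : lambda_min (Z u x S) < 1 -> cshift u p eps x S <= alpha d p eps.
Proof.
move=> lam1; have [e [w [wZ w0 e1]]] : exists e, exists w : 'rV[R]_d,
    [/\ w *m Z u x S = e *: w, w != 0 & e < 1].
  apply: contrapT => noe; move: lam1; rewrite ltNge => /negP; apply.
  apply: lb_le_inf.
    (* Nonemptiness of the spectrum matters: the infimum of an empty set defaults to 0, which is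
       below 1. *)
    have [b [w wE w0]] := sym_real_eigen d_gt0 (trmx_Z S).
    by exists b; apply/eigenvalueP; exists w.
  move=> b /eigenvalueP [w wE w0]; rewrite leNgt; apply/negP => b1.
  by apply: noe; exists b, w.
have [[_ pK] _] := shifted_spec S.
have /pK : w^T != 0 by apply: contra_neq w0 => w0; rewrite -[w]trmxK w0 trmx0.
rewrite /qform trmxK mulmxBr -scalemxAr wZ mul_mx_scalar scalerA -scalerBl.
rewrite -scalemxAl mxE => lt0.
have ww : 0 <= (w *m w^T) 0 0.
  by rewrite mxE sumr_ge0 // => i _; rewrite [_^T _ _]mxE -expr2 sqr_ge0.
have : cshift u p eps x S < alpha d p eps * e.
  rewrite -subr_gt0 ltNge; apply/negP => le0.
  by move: lt0; rewrite ltNge mulr_le0_ge0.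
by move=> /ltW /le_trans; apply; rewrite ler_piMr ?alpha_ge0 // ltW.
Qed.

(** Writing [alpha Z = K + c I] with [K] the shifted matrix, the sum is
    [tr (alpha Z K^-1) = d + c tr K^-1], and [c <= alpha]. *)
Lemma sum_awt S : lambda_min (Z u x S) < 1 ->
  \sum_(i in S) a S i <= d%:R + d%:R / g.
Proof.
move=> /cshift_le cle; have [pdK _] := shifted_spec S.
have -> : \sum_(i in S) a S i = d%:R + cshift u p eps x S * \tr (invmx (shifted S)).
  transitivity (\tr (alpha d p eps *: Z u x S *m invmx (shifted S))).
    rewrite -scalemxAl mxtraceZ mulmx_suml raddf_sum /= mulr_sumr.
    apply: eq_bigr => i _; rewrite awtE -mxdot_outer /mxdot /outer trmx_mul trmxK //.
  have -> : alpha d p eps *: Z u x S = shifted S + (cshift u p eps x S)%:M.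
    by rewrite /shifted subrK.
  rewrite mulmxDl mulmxV ?pdmx_unit // mul_scalar_mx mxtraceD mxtrace1 mxtraceZ //.
have /andP[tr0 trd] := tr_inv_shifted S.
rewrite lerD2l -alpha_sqrt; apply: le_trans (ler_wpM2r tr0 cle) _.
by rewrite ler_wpM2l ?alpha_ge0.
Qed.

(** * Leverage scores *)

Definition lev S i := mxdot (outer (v u x i)) (pinvmx (Z u x S)).

(** If [Z z = 0], then [z^T Z z], a sum of squares [(v_j . z)^2], vanishes; so [v_i] is orthogonal
    to the kernel of the symmetric [Z]. *)
Lemma v_sub_Z S i : i \in S -> ((v u x i)^T <= Z u x S)%MS.
Proof.
move=> iS; rewrite submxE; set N := cokermx _; apply/eqP/matrixP => k l.
pose z : 'cV_d := N *m delta_mx l 0.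
have q0 : qform (Z u x S) z = 0.
  by rewrite /qform -mulmxA /z (mulmxA (Z u x S)) mulmx_coker mul0mx mulmx0 mxE.
rewrite qform_sum in q0.
have o0 j : j \in S -> 0 <= qform (outer (v u x j)) z by rewrite qform_outer sqr_ge0.
have /eqP := psumr_eq0P o0 q0 iS; rewrite qform_outer sqrf_eq0 /z mulmxA -colE !mxE => /eqP vN.
by rewrite ord1 -[RHS]vN.
Qed.

(** Positivity is taken from [Z] rather than from its generalized inverse: with [y = v_i^T Z^+] and
    [y Z = v_i^T], the score equals [y Z y^T]. *)
Lemma lev_ge0 S i : i \in S -> 0 <= lev S i.
Proof.
move=> iS; rewrite /lev mxdot_outer /qform; set w := (v u x i)^T.
have vE : v u x i = w^T by rewrite trmxK.
have wZ := mulmxKpV (v_sub_Z iS); rewrite -/w in wZ.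
set y := w *m pinvmx _ in wZ *.
rewrite vE -wZ trmx_mul trmx_Z mulmxA.
have -> : (y *m Z u x S *m y^T) 0 0 = qform (Z u x S) y^T by rewrite /qform trmxK.
rewrite qform_sum sumr_ge0 // => j _.
by rewrite qform_outer sqr_ge0.
Qed.

Lemma sum_lev S : \sum_(i in S) lev S i <= d%:R.
Proof.
apply: le_trans (tr_mul_pinvmx (Z u x S)); rewrite mulmx_suml raddf_sum /=.
by apply: ler_sum => i _; rewrite /lev /mxdot /outer trmx_mul trmxK.
Qed.

(** * Valid sets, exchange masses and their drift *)

(* Indices with x = 1 are never removed and those with x = 0 never added, so
   this property is preserved, and under it only the at most d^2 + 1 fractional
   indices carry exchange weight, so the weights sum to at most 1. *)
Definition valid S := forall i, (x i = 1 -> i \in S) /\ (x i = 0 -> i \notin S).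

(** [add_mass] and [rem_mass] are the quantities [P] and [N] of the outline. *)
Definition add_mass S := \sum_(j | j \notin S) x j * (1 + a S j).

Definition rem_mass S :=
  \sum_(i in removable u p eps x S) (1 - x i) * (1 - a S i).

Lemma sum_add_wt S : \sum_j add_wt u p eps x S j = add_mass S / M.
Proof.
rewrite /add_mass mulr_suml [RHS]big_mkcond /=; apply: eq_bigr => j _.
by rewrite /add_wt mulrAC.
Qed.

Lemma sum_rem_wt S : \sum_i rem_wt u p eps x S i = rem_mass S / M.
Proof.
rewrite /rem_mass mulr_suml [RHS]big_mkcond /=; apply: eq_bigr => i _.
by rewrite /rem_wt mulrAC.
Qed.

Lemma add_wt_ge0 S j : 0 <= add_wt u p eps x S j.
Proof.
rewrite /add_wt; case: ifP => // _; have /andP[x0 _] := x01 j.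
by rewrite mulr_ge0 ?divr_ge0 ?(ltW bigM_gt0) ?addr_ge0 ?awt_ge0.
Qed.

Lemma rem_wt_ge0 S i : 0 <= rem_wt u p eps x S i.
Proof.
rewrite /rem_wt; case: ifP => // /[!inE] /and3P[_ a1 _]; have /andP[_ x1] := x01 i.
rewrite mulr_ge0 ?divr_ge0 ?(ltW bigM_gt0) ?subr_ge0 //.
by apply: le_trans a1 _; lra.
Qed.

Lemma fractional_valid S i : valid S ->
  (i \notin S -> 0 < x i -> i \in fractional x) /\
  (i \in S -> x i < 1 -> i \in fractional x).
Proof.
move=> /(_ i) [x1 x0]; have /andP[xi0 xi1] := x01 i; rewrite !inE; split=> iS xi.
  by rewrite xi lt_neqAle xi1 andbT; apply: contra iS => /eqP.
by rewrite xi andbT lt_neqAle xi0 andbT eq_sym; apply: contraL iS => /eqP.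
Qed.

Lemma card_fractional_ler : #|fractional x|%:R <= d%:R ^+ 2 + 1 :> R.
Proof. by rewrite -natrX natr1 ler_nat -addn1. Qed.

Lemma add_mass_le S : add_mass S <= \sum_(j | j \notin S) x j + d%:R / g.
Proof.
rewrite /add_mass; under eq_bigr => j _ do rewrite mulrDr mulr1.
rewrite big_split /= lerD2l; apply: le_trans (sum_x_awt S).
rewrite [leRHS](bigID (fun j => j \notin S)) /= lerDl sumr_ge0 // => j _.
by rewrite mulr_ge0 ?awt_ge0 //; case/andP: (x01 j).
Qed.

(** Outside a valid set only fractional indices have positive [x], so these values add up to at most
    [d^2 + 1]; the weights add at most [d / gamma]. *)
Lemma add_mass_leM S : valid S -> add_mass S <= M.
Proof.
move=> vS; apply: le_trans (add_mass_le S) _.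
rewrite /bigM addrC -addrA lerD2l; apply: le_trans card_fractional_ler.
rewrite -sumr_const big_mkcond [leRHS]big_mkcond /=; apply: ler_sum => j _.
have /andP[xj0 xj1] := x01 j; have [fS _] := fractional_valid j vS.
case: ifP => // jS; last by case: ifP.
have [xj|] := ltP 0 (x j); first by rewrite fS.
by move=> xj; apply: le_trans xj _; case: ifP.
Qed.

Lemma add_mass_le_sum S : add_mass S <= \sum_i x i + d%:R / g.
Proof.
apply: le_trans (add_mass_le S) _; rewrite lerD2r.
rewrite [leRHS](bigID (fun j => j \notin S)) /= lerDl sumr_ge0 // => j _.
by case/andP: (x01 j).
Qed.

(** Each fractional index contributes at most 1, its weight lying in [0, 1/2]; an index with
    [x i = 1] contributes 0. *)
Lemma rem_mass_leM S : valid S -> rem_mass S <= M.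
Proof.
move=> vS; apply: (@le_trans _ _ (#|fractional x|%:R)); last first.
  apply: le_trans card_fractional_ler _; rewrite /bigM -addrA lerDr.
  by rewrite divr_ge0 // ltW // gamma_gt0.
rewrite -sumr_const /rem_mass big_mkcond [leRHS]big_mkcond /=; apply: ler_sum => i _.
have /andP[xi0 xi1] := x01 i; have [_ fS] := fractional_valid i vS.
have a0 := awt_ge0 S i.
case: ifP => [iR|_]; last by case: ifP.
have := iR; rewrite inE => /and3P[iS a1 _].
have [xi|xi] := ltP (x i) 1; first by rewrite fS //; nra.
have -> : x i = 1 by lra.
by rewrite subrr mul0r; case: ifP.
Qed.

(* An index of S outside [removable S] has awt > 1/2 or leverage > kappa, whence
   [1 <= 2 * awt + lev / kappa] for it. *)
Lemma mass_drift S : lambda_min (Z u x S) < 1 ->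
  add_mass S - rem_mass S <=
  \sum_i x i - #|S|%:R + (3 * (d%:R / g) + 2 * d%:R + d%:R / kap).
Proof.
move=> lam1; have k0 := kappa_gt0.
have HA := sum_awt lam1.
have HL : (\sum_(i in S) lev S i) / kap <= d%:R / kap.
  by rewrite ler_pM2r ?invr_gt0 // sum_lev.
have HX := add_mass_le S.
have HR : - rem_mass S <=
    \sum_(i in S) x i - #|S|%:R + 2 * \sum_(i in S) a S i + (\sum_(i in S) lev S i) / kap.
  rewrite -sumr_const mulr_sumr mulr_suml -sumrB -!big_split /=.
  rewrite /rem_mass -sumrN.
  rewrite big_mkcond [leRHS]big_mkcond /=; apply: ler_sum => i _.
  have /andP[xi0 xi1] := x01 i; have a0 := awt_ge0 S i.
  rewrite inE; case: (boolP (i \in S)) => [iS|_] /=; last by [].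
  have l0 : 0 <= lev S i / kap by rewrite divr_ge0 ?lev_ge0 // ltW.
  case: ifPn => [/andP[a1 _]|]; first by have := mulr_ge0 xi0 a0; lra.
  rewrite negb_and -!ltNge => /orP[a1|]; first by lra.
  rewrite -/(lev S i) => lk.
  have : 1 <= lev S i / kap by rewrite ler_pdivlMr // mul1r ltW.
  lra.
(* The sums of [x] inside and outside [S] combine to [n]. The constant collects [d / gamma] from
   additions, [2 (d + d / gamma)] from the weights and [d / kappa] from the leverage scores. *)
rewrite (bigID (fun j => j \notin S)) /=; under [X in _ + X - _]eq_bigl => j do rewrite negbK.
lra.
Qed.

(** * One exchange: total mass, cardinality and validity *)

Lemma exchange_prob_sum S (F : {set 'I_m} -> R) :
  \sum_T exchange_prob u p eps x S T * F T =
  \sum_j \sum_i law (addw S) j * law (remw S) i * F (exchange S j i).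
Proof.
under eq_bigr => T _ do rewrite mulr_suml.
rewrite exchange_big; apply: eq_bigr => j _ /=.
rewrite [RHS](partition_big (fun i => exchange S j i) xpredT) //=.
apply: eq_bigr => T _; rewrite mulr_suml.
by apply: eq_bigr => i /eqP ->.
Qed.

Lemma exchange_prob_mass S : \sum_T exchange_prob u p eps x S T = 1.
Proof.
under eq_bigr => T _ do rewrite -[exchange_prob _ _ _ _ _ _]mulr1.
rewrite (exchange_prob_sum S (fun=> 1)).
under eq_bigr => j _ do rewrite -mulr_suml -mulr_sumr sum_law mulr1 mulr1.
exact: sum_law.
Qed.

Lemma step_prob_mass t S : \sum_T step_prob u p eps x t S T = 1.
Proof.
rewrite /step_prob; case: stop; last exact: exchange_prob_mass.
by rewrite (bigD1 S) //= eqxx big1 ?addr0 // => T /negbTE ->.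
Qed.

(** This support condition is what fixes the change of cardinality and preserves validity. *)
Lemma exchange_cond S j i :
  law (addw S) j * law (remw S) i != 0 ->
  (if j is Some j0 then (j0 \notin S) && (x j0 != 0) else true) &&
  (if i is Some i0 then (i0 \in S) && (x i0 != 1) else true).
Proof.
rewrite mulf_eq0 negb_or => /andP[wj wi]; apply/andP; split.
  case: j wj => [j|//] /=; rewrite /add_wt; case: ifP => [_|]; last by rewrite eqxx.
  by move=> /=; apply: contra_neq => ->; rewrite !mul0r.
case: i wi => [i|//] /=; rewrite /rem_wt; case: ifP => [iR|]; last by rewrite eqxx.
move: iR; rewrite inE => /andP[-> _] /=.
by apply: contra_neq => ->; rewrite subrr !mul0r.
Qed.

Lemma exchange_card S j i :
  law (addw S) j * law (remw S) i != 0 ->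
  (#|exchange S j i|%:R : R) = #|S|%:R
    + (if j is Some _ then 1 else 0) + (if i is Some _ then -1 else 0).
Proof.
move=> /exchange_cond /andP[cj ci]; rewrite /exchange.
have -> : #|S|%:R + (if j is Some _ then 1 else 0) = #|S :|: oset j|%:R :> R.
  case: j cj => [j /andP[jS _]|_] /=; last by rewrite finset.setU0 addr0.
  by rewrite finset.setUC cardsU1 jS natrD addrC.
case: i ci => [i /andP[iS _]|_] /=; last by rewrite finset.setD0 addr0.
rewrite (cardsD1 i (S :|: oset j)) inE iS natrD.
by rewrite addrC addKr.
Qed.

Lemma exchange_valid S j i : valid S ->
  law (addw S) j * law (remw S) i != 0 -> valid (exchange S j i).
Proof.
move=> vS /exchange_cond /andP[cj ci] k; have [k1 k0] := vS k.
split=> xk; rewrite /exchange !inE.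
  rewrite k1 // orTb andbT; case: i ci => [i /andP[_ xi]|_] /=; rewrite inE //.
  by apply: contra_neq xi => <-.
rewrite negb_and negb_or k0 //=; apply/orP; right.
case: j cj => [j /andP[_ xj]|_] /=; rewrite inE //.
by apply: contra_neq xj => <-.
Qed.

Lemma law_add_ge0 S j : valid S -> 0 <= law (addw S) j.
Proof.
move=> vS; apply: law_ge0 => [i|]; first exact: add_wt_ge0.
by rewrite sum_add_wt ler_pdivrMr ?bigM_gt0 // mul1r add_mass_leM.
Qed.

Lemma law_rem_ge0 S i : valid S -> 0 <= law (remw S) i.
Proof.
move=> vS; apply: law_ge0 => [k|]; first exact: rem_wt_ge0.
by rewrite sum_rem_wt ler_pdivrMr ?bigM_gt0 // mul1r rem_mass_leM.
Qed.

Lemma exchange_prob_ge0 S T : valid S -> 0 <= exchange_prob u p eps x S T.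
Proof.
move=> vS; apply: sumr_ge0 => j _; apply: sumr_ge0 => i _.
by rewrite mulr_ge0 ?law_add_ge0 ?law_rem_ge0.
Qed.

Lemma exchange_prob_valid S T : valid S -> exchange_prob u p eps x S T != 0 ->
  valid T.
Proof.
move=> vS; apply: contra_neqP => vT; apply: big1 => j _.
apply: big1 => i /eqP ET; apply/eqP; apply: contraT => w0.
by case: vT; rewrite -ET; apply: exchange_valid.
Qed.

(** * Exponential moments of one exchange *)

Local Notation n := (\sum_i x i).

Lemma sum_x_ge0 : 0 <= n.
Proof. by apply: sumr_ge0 => i _; case/andP: (x01 i). Qed.

Lemma add_mass_ge0 S : 0 <= add_mass S.
Proof.
apply: sumr_ge0 => j _; have /andP[x0 _] := x01 j.
by rewrite mulr_ge0 ?addr_ge0 ?awt_ge0.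
Qed.

(** Independence of the two choices factorizes the exponential moment. *)
Lemma exchange_mgf lam S :
  \sum_T exchange_prob u p eps x S T * expR (lam * #|T|%:R) =
  expR (lam * #|S|%:R) * ((1 + add_mass S / M * (expR lam - 1)) *
                          (1 + rem_mass S / M * (expR (- lam) - 1))).
Proof.
rewrite exchange_prob_sum -sum_add_wt -sum_rem_wt -!sum_law_cond.
rewrite mulr_suml mulr_sumr; apply: eq_bigr => j _.
rewrite !mulr_sumr; apply: eq_bigr => i _.
(* The cardinality formula is only available for pairs of nonzero probability. *)
have [w0|w0] := eqVneq (law (addw S) j * law (remw S) i) 0.
  by rewrite w0 mul0r mulrACA w0 !(mul0r, mulr0).
rewrite (exchange_card w0) !mulrDr !expRD.
case: j {w0} => [j|]; case: i => [i|]; rewrite ?mulr1 ?mulr0 ?mulrN1 ?expR0; ring.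
Qed.

Local Notation c0 := (3 * (d%:R / g) + 2 * d%:R + d%:R / kap).
Local Notation level lam := (n + c0 + (n + d%:R / g) * (expR lam - 1)).

(** Averaging the tangent-line bounds at the point [s] gives exactly [expR s], because the linear
    corrections cancel. *)
Lemma expR_convex (t y z : R) : 0 <= t <= 1 ->
  expR ((1 - t) * y + t * z) <= (1 - t) * expR y + t * expR z.
Proof.
move=> /andP[t0 t1]; set s := (1 - t) * y + t * z.
have tangent w : expR s * (1 + (w - s)) <= expR w.
  have -> : expR w = expR s * expR (w - s) by rewrite -expRD addrC subrK.
  by rewrite ler_pM2l ?expR_gt0 // expR_ge1Dx.
have := ler_wpM2l t0 (tangent z).
have : 0 <= 1 - t by lra.
move=> /ler_wpM2l /(_ _ _ (tangent y)) Hy Hz.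
have -> : expR s = (1 - t) * (expR s * (1 + (y - s))) + t * (expR s * (1 + (z - s))).
  rewrite /s; ring.
by rewrite lerD.
Qed.

(** Applying [1 + y <= e^y] to both factors moves the drift bound into the exponent, which becomes
    at most [(1 - rho) lam |S| + rho lam b]; convexity of the exponential then makes the recursion
    affine. *)
Lemma exchange_mgf_le lam S (rho := (1 - expR (- lam)) / (M * lam)) :
  0 < lam -> valid S -> lambda_min (Z u x S) < 1 ->
  \sum_T exchange_prob u p eps x S T * expR (lam * #|T|%:R) <=
  (1 - rho) * expR (lam * #|S|%:R) + rho * expR (lam * level lam).
Proof.
move=> lam0 vS lam1; rewrite exchange_mgf.
set b := level lam.
set P := add_mass S; set N := rem_mass S; set E := expR lam in b *; set s := #|S|%:R.
have M0 := bigM_gt0; have M1 := bigM_ge1.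
have E1 : 1 <= E by rewrite -expR0 ler_expR ltW.
have EV : E * expR (- lam) = 1 by rewrite -expRD subrr expR0.
have V0 : 0 < expR (- lam) := expR_gt0 _.
have V1 : expR (- lam) <= 1 by rewrite -expR0 ler_expR oppr_le0 ltW.
have Vlam : 1 - lam <= expR (- lam) := expR_ge1Dx _.
have P0 : 0 <= P by apply: add_mass_ge0.
have NM : N / M <= 1 by rewrite ler_pdivrMr // mul1r rem_mass_leM.
have rho01 : 0 <= rho <= 1.
  rewrite /rho divr_ge0 ?mulr_ge0 ?(ltW M0) ?(ltW lam0) ?subr_ge0 //=.
  rewrite ler_pdivrMr ?mulr_gt0 // mul1r; nra.
apply: le_trans (expR_convex _ _ rho01).
have -> : (1 - rho) * (lam * s) + rho * (lam * b) =
    lam * s + (1 - expR (- lam)) / M * (b - s).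
  by rewrite /rho; field; rewrite !gt_eqF.
rewrite expRD ler_pM2l ?expR_gt0 //.
apply: (@le_trans _ _ (expR (P / M * (E - 1)) * expR (N / M * (expR (- lam) - 1)))).
  apply: ler_pM; rewrite ?expR_ge1Dx //.
    by rewrite addr_ge0 // mulr_ge0 ?divr_ge0 ?subr_ge0 // ltW.
  (* The removal factor is nonnegative because [N / M <= 1] and [expR (- lam) - 1 > -1]. *)
  nra.
rewrite -expRD ler_expR.
(* Since [E - 1 = E (1 - e^-lam)], both terms share a factor; the rest, [P E - N], is split so that
   the bounds on [P] and on [P - N] apply. *)
have -> : P / M * (E - 1) + N / M * (expR (- lam) - 1) =
    (1 - expR (- lam)) / M * (P * (E - 1) + (P - N)).
  have EE : E - 1 = E * (1 - expR (- lam)) by rewrite mulrBr EV mulr1.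
  have -> : P * (E - 1) + (P - N) = P * E - N by ring.
  rewrite EE; ring.
rewrite ler_wpM2l ?divr_ge0 ?subr_ge0 ?(ltW M0) //.
have drift := mass_drift lam1.
have PE : P * (E - 1) <= (n + d%:R / g) * (E - 1).
  by rewrite ler_wpM2r ?subr_ge0 // add_mass_le_sum.
rewrite -/P -/N -/s in drift; rewrite /b; lra.
Qed.

(* Needed for the first exchange, as lambda_min (Z S_0) is not assumed < 1. *)
Lemma exchange_mgf_first lam S : 0 <= lam -> valid S ->
  \sum_T exchange_prob u p eps x S T * expR (lam * #|T|%:R) <=
  expR lam * expR (lam * #|S|%:R).
Proof.
move=> lam0 vS; rewrite exchange_mgf mulrC ler_wpM2r ?expR_ge0 //.
have E1 : 1 <= expR lam by rewrite -expR0 ler_expR.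
have V1 : expR (- lam) <= 1 by rewrite -expR0 ler_expR oppr_le0.
have V0 : 0 < expR (- lam) := expR_gt0 _.
have M0 := bigM_gt0.
have PM : 0 <= add_mass S / M <= 1.
  rewrite -sum_add_wt sumr_ge0 => [|i _]; last exact: add_wt_ge0.
  by rewrite sum_add_wt ler_pdivrMr // mul1r add_mass_leM.
have NM : 0 <= rem_mass S / M <= 1.
  rewrite -sum_rem_wt sumr_ge0 => [|i _]; last exact: rem_wt_ge0.
  by rewrite sum_rem_wt ler_pdivrMr // mul1r rem_mass_leM.
move: PM NM => /andP[PM0 PM1] /andP[NM0 NM1].
(* The addition factor is at most [expR lam], the removal factor at most 1. *)
rewrite -[leRHS]mulr1; apply: ler_pM; nra.
Qed.


(** * The random initial set *)

Lemma init_prob_ge0 S : 0 <= init_prob x S.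
Proof.
rewrite mulr_ge0 ?prodr_ge0 // => i _; first by case/andP: (x01 i).
by rewrite subr_ge0; case/andP: (x01 i).
Qed.

Lemma init_prob_valid S : init_prob x S != 0 -> valid S.
Proof.
rewrite mulf_eq0 negb_or => /andP[/prodf_neq0 S1 /prodf_neq0 S0] i; split=> xi.
  by apply: contraT => iS; have := S0 i; rewrite inE iS xi subrr eqxx => /(_ isT).
by apply/negP => iS; have := S1 i iS; rewrite xi eqxx.
Qed.

(** Expand the product over subsets: each index is either chosen, with factor [x i * expR lam], or
    left out, with factor [1 - x i]. *)
Lemma init_mgf lam :
  \sum_S init_prob x S * expR (lam * #|S|%:R) =
  \prod_i (1 + x i * (expR lam - 1)).
Proof.
transitivity (\prod_i (x i * expR lam + (1 - x i))); last first.
  by apply: eq_bigr => i _; ring.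
rewrite bigA_distr; apply: eq_bigr => S _.
rewrite (bigID (fun i => i \in S)) /= mulrAC /init_prob; congr (_ * _); last first.
  by apply: eq_big => i; rewrite inE // => /negbTE ->.
have -> : \prod_(i in S) (if i \in S then x i * expR lam else 1 - x i) =
    \prod_(i in S) (x i * expR lam) by apply: eq_bigr => i ->.
by rewrite big_split /= prodr_const -expRM_natl [_ * lam]mulrC.
Qed.

Lemma init_mass : \sum_S init_prob x S = 1.
Proof.
transitivity (\sum_S init_prob x S * expR (0 * #|S|%:R)).
  by apply: eq_bigr => S _; rewrite mul0r expR0 mulr1.
by rewrite init_mgf; apply: big1 => i _; rewrite expR0 subrr mulr0 addr0.
Qed.

Lemma init_mgf_le lam : \sum_S init_prob x S * expR (lam * #|S|%:R) <=
  expR (n * (expR lam - 1)).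
Proof.
rewrite init_mgf mulr_suml expR_sum; apply: ler_prod => i _.
rewrite expR_ge1Dx andbT; have /andP[x0 x1] := x01 i.
have := expR_gt0 lam; nra.
Qed.

(** * The killed chain *)

(* Killing the chain as soon as it stops or lambda_min reaches 1 turns the
   conditional tail bound into an unconditional one for a sub-Markov kernel. *)
Definition live_step t S T : R :=
  step_prob u p eps x t.+1 S T *
  (~~ stop u p eps x t.+1 S && (lambda_min (Z u x T) < 1))%:R.

Definition live_law := path_law (init_prob x) live_step.

Lemma live_step_ge0 t S T : valid S -> 0 <= live_step t S T.
Proof.
move=> vS; rewrite /live_step /step_prob; case: stop => /=; first by rewrite mulr0.
by rewrite mulr_ge0 ?exchange_prob_ge0.
Qed.

Lemma live_step_le t S T : valid S -> live_step t S T <= exchange_prob u p eps x S T.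
Proof.
move=> vS; rewrite /live_step /step_prob.
have := exchange_prob_ge0 T vS; case: stop => /=; first by rewrite mulr0.
by move=> H; case: (_ < _); rewrite ?mulr1 ?mulr0.
Qed.

Lemma live_lawS t T :
  live_law t.+1 T = \sum_S live_law t S * live_step t S T.
Proof. by []. Qed.

(** Sign and support are proved together, since the kernel is known to be nonnegative only from
    valid sets. The guard [0 < t] reflects that the initial set is not tested for its eigenvalue. *)
Lemma live_law_inv t :
  (forall S, 0 <= live_law t S) /\
  (forall S, live_law t S != 0 ->
     valid S /\ ((0 < t)%N -> lambda_min (Z u x S) < 1)).
Proof.
elim: t => [|t [ge0 IH]].
  by split=> S; [exact: init_prob_ge0 | move=> /init_prob_valid].
split=> T.
  rewrite live_lawS; apply: sumr_ge0 => S _; have [->|/IH [vS _]] := eqVneq (live_law t S) 0.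
    by rewrite mul0r.
  by rewrite mulr_ge0 ?live_step_ge0.
move=> lT; have [S] : exists S, live_law t S * live_step t S T != 0.
  apply: contrapT => noS; case/eqP: lT; rewrite live_lawS; apply: big1 => S _.
  by apply/eqP; apply: contraT => ST; case: noS; exists S.
rewrite mulf_eq0 negb_or => /andP[/IH [vS _]].
rewrite /live_step /step_prob; case: stop => /=; first by rewrite mulr0 eqxx.
rewrite mulf_eq0 negb_or => /andP[/(exchange_prob_valid vS) vT].
by case: (ltP (lambda_min (Z u x T)) 1) => //; rewrite eqxx.
Qed.

(** On the support of the live law the killed kernel is dominated by the plain exchange kernel, so
    one-step bounds for the latter transfer. *)
Lemma live_step_sum t (h : {set 'I_m} -> R) (k : {set 'I_m} -> R) :
  (forall S, 0 <= h S) ->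
  (forall S, live_law t S != 0 ->
     \sum_T exchange_prob u p eps x S T * h T <= k S) ->
  \sum_T live_law t.+1 T * h T <= \sum_S live_law t S * k S.
Proof.
move=> h0 hk; have [ge0 vS] := live_law_inv t.
have -> : \sum_T live_law t.+1 T * h T =
    \sum_T \sum_S live_law t S * (live_step t S T * h T).
  apply: eq_bigr => T _; rewrite live_lawS mulr_suml.
  by apply: eq_bigr => S _; rewrite -[LHS]mulrA.
rewrite exchange_big /=; apply: ler_sum => S _; rewrite -mulr_sumr.
have [->|S0] := eqVneq (live_law t S) 0; first by rewrite !mul0r.
rewrite ler_wpM2l //; apply: le_trans (hk S S0); apply: ler_sum => T _.
by rewrite ler_wpM2r // live_step_le //; case: (vS S S0).
Qed.

Lemma live_mass t : \sum_S live_law t S <= 1.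
Proof.
elim: t => [|t IH]; first by rewrite init_mass.
apply: le_trans IH.
under eq_bigr => S _ do rewrite -[live_law _ _]mulr1.
under [leRHS]eq_bigr => S _ do rewrite -[live_law _ _]mulr1.
apply: live_step_sum => // S _.
by under eq_bigr => T _ do rewrite mulr1; rewrite exchange_prob_mass.
Qed.

(** The spare 1, provided by [2 d], absorbs the factor [expR lam] lost in the first exchange. *)
Lemma level_ge lam : 0 <= lam -> n * expR lam + 1 <= level lam.
Proof.
move=> lam0; have E1 : 1 <= expR lam by rewrite -expR0 ler_expR.
have d1 : 1 <= d%:R :> R by rewrite ler1n.
have g0 := gamma_gt0; have k0 := kappa_gt0.
have dg0 : 0 <= d%:R / g by rewrite divr_ge0 // ltW.
have dk0 : 0 <= d%:R / kap by rewrite divr_ge0 // ltW.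
have : 0 <= d%:R / g * (expR lam - 1) by rewrite mulr_ge0 ?subr_ge0.
lra.
Qed.

(** [W0] covers times 0 and 1; from time 1 on the eigenvalue bound holds and the affine recursion
    applies. *)
Lemma live_mgf lam t : 0 < lam ->
  \sum_S live_law t S * expR (lam * #|S|%:R) <= expR (lam * level lam).
Proof.
move=> lam0; have n0 := sum_x_ge0.
have E0 := expR_gt0 lam; have V0 := expR_gt0 (- lam).
have EV : expR lam * expR (- lam) = 1 by rewrite -expRD subrr expR0.
have Vlam : 1 - lam <= expR (- lam) := expR_ge1Dx _.
have lvl := level_ge (ltW lam0).
have ElE : expR lam - 1 <= lam * expR lam by nra.
have W0 : expR lam * expR (n * (expR lam - 1)) <= expR (lam * level lam).
  rewrite -expRD ler_expR.
  have := ler_wpM2l (ltW lam0) lvl; have := ler_wpM2l n0 ElE; lra.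
case: t => [|t].
  apply: le_trans (init_mgf_le lam) (le_trans _ W0).
  by rewrite ler_peMl ?expR_ge0 // -expR0 ler_expR ltW.
elim: t => [|t IH].
  apply: (@le_trans _ _ (\sum_S live_law 0 S * (expR lam * expR (lam * #|S|%:R)))).
    apply: live_step_sum => S; first exact: expR_ge0.
    by case: (live_law_inv 0) => _ /[apply] -[vS _]; apply: exchange_mgf_first => //; exact: ltW.
  apply: le_trans W0; under eq_bigr => S _ do rewrite mulrCA.
  by rewrite -mulr_sumr ler_pM2l // init_mgf_le.
pose rho := (1 - expR (- lam)) / (M * lam).
apply: (@le_trans _ _ (\sum_S live_law t.+1 S *
   ((1 - rho) * expR (lam * #|S|%:R) + rho * expR (lam * level lam)))).
  apply: live_step_sum => S; first exact: expR_ge0.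
  by case: (live_law_inv t.+1) => _ /[apply] -[vS /(_ isT)]; exact: exchange_mgf_le.
have M1 := bigM_ge1; have M0 := bigM_gt0.
have V1 : expR (- lam) <= 1 by rewrite -expR0 ler_expR oppr_le0 ltW.
have [rho0 rho1] : 0 <= rho /\ rho <= 1.
  split; first by rewrite /rho divr_ge0 ?mulr_ge0 ?subr_ge0 // ltW.
  rewrite /rho ler_pdivrMr ?mulr_gt0 // mul1r; nra.
have -> : \sum_S live_law t.+1 S *
   ((1 - rho) * expR (lam * #|S|%:R) + rho * expR (lam * level lam)) =
   (1 - rho) * (\sum_S live_law t.+1 S * expR (lam * #|S|%:R)) +
   rho * expR (lam * level lam) * (\sum_S live_law t.+1 S).
  rewrite !mulr_sumr -big_split; apply: eq_bigr => S _ /=; ring.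
(* The claimed bound is the fixed point of the recursion; the constant term is multiplied by the
   live mass, at most 1. *)
apply: (@le_trans _ _ ((1 - rho) * expR (lam * level lam)
   + rho * expR (lam * level lam) * 1)); last first.
  by rewrite mulr1 -mulrDl subrK mul1r.
apply: lerD; first by rewrite ler_wpM2l ?subr_ge0.
by rewrite ler_wpM2l ?live_mass // mulr_ge0 ?expR_ge0.
Qed.

(** * From trajectories to the tail bound *)

Lemma prod_bool_nat (I : finType) (b : pred I) :
  \prod_i (b i)%:R = [forall i, b i]%:R :> R.
Proof.
case: forallP => [bT|nb]; first by apply: big1 => i _; rewrite bT.
have [i bi] : exists i, ~~ b i.
  by apply/existsP; rewrite -negb_forall; apply/forallP.
by rewrite (bigD1 i) //= (negbTE bi) mul0r.
Qed.

(** The complement consists of the trajectories that survive to [tau] and end outside [E]. On them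
    the killed weight equals [traj_prob], and it is 0 on trajectories that do not survive. *)
Lemma Pr_live tau (E : pred {set 'I_m}) :
  Pr u p eps x (fun s : traj m tau => produced u p eps x s &&
      small_lambda_min u x s ==> E (at_time s tau)) =
  1 - \sum_(S | ~~ E S) live_law tau S.
Proof.
have total : \sum_(s : traj m tau) traj_prob u p eps x s = 1.
  have := sum_paths (init_prob x) (fun t => step_prob u p eps x t.+1) tau (fun=> 1).
  under eq_bigr => s _ do rewrite mulr1.
  under [RHS]eq_bigr => s _ do rewrite mulr1.
  rewrite path_law_mass => [|t S]; last exact: step_prob_mass.
  by rewrite init_mass => <-.
set B := fun s : traj m tau => _.
rewrite -total [in RHS](bigID B) /= -/(Pr _ _ _ _ B).
suff -> : \sum_(s | ~~ B s) traj_prob u p eps x s = \sum_(S | ~~ E S) live_law tau S.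
  by rewrite addrK.
have -> : \sum_(S | ~~ E S) live_law tau S = \sum_S live_law tau S * (~~ E S)%:R.
  by rewrite big_mkcond; apply: eq_bigr => S _; case: (E S); rewrite ?mulr0 ?mulr1.
rewrite -sum_paths big_mkcond; apply: eq_bigr => s _.
rewrite /live_step big_split /= prod_bool_nat.
rewrite /B negb_imply /traj_prob /at_time.
have -> : [forall t : 'I_tau, ~~ stop u p eps x t.+1 (s (inord t)) &&
     (lambda_min (Z u x (s (inord t.+1))) < 1)] =
   produced u p eps x s && small_lambda_min u x s.
  apply/forallP/andP => [H|[/forallP H1 /forallP H2] t]; last by rewrite H1 H2.
  by split; apply/forallP => t; have /andP[] := H t.
by case: (produced u p eps x s && small_lambda_min u x s); case: (E _); rewrite /= ?mulr1 ?mulr0.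
Qed.

Lemma tail_bound tau delta : 0 <= delta <= 1 ->
  \sum_(S : {set 'I_m} | ~~ (#|S|%:R <= (1 + delta) * n +
      (12 * d%:R / g + 2 * d%:R / kap))) live_law tau S <=
  expR (- (delta * d%:R / g)).
Proof.
move=> /andP[delta0 delta1]; have [ge0 _] := live_law_inv tau.
(* At [delta = 0] the parameter [lam] would vanish; the claim is then that the live mass is at most
   1. *)
move: delta0; rewrite le_eqVlt => /orP[/eqP <-|delta0].
  rewrite !mul0r oppr0 expR0; apply: le_trans (live_mass tau).
  rewrite big_mkcond; apply: ler_sum => S _; by case: ifP.
pose lam := delta / 2; have lam0 : 0 < lam by rewrite /lam; lra.
set b := (1 + delta) * n + _.
apply: (@le_trans _ _ (expR (- (lam * b)) * expR (lam * level lam))).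
  apply: le_trans (ler_wpM2l (expR_ge0 _) (live_mgf tau lam0)).
  rewrite mulr_sumr big_mkcond; apply: ler_sum => S _.
  rewrite mulrCA -expRD -ltNge; case: ifP => [bS|_]; last by rewrite mulr_ge0 ?expR_ge0.
  (* Markov's inequality: here [|S| > b], so [expR (lam |S| - lam b)] is at least 1. *)
  rewrite ler_peMr // (le_trans _ (expR_ge1Dx _)) // lerDl addrC subr_ge0.
  by rewrite ler_pM2l // ltW.
rewrite -expRD ler_expR.
have E0 := expR_gt0 lam.
have EV : expR lam * expR (- lam) = 1 by rewrite -expRD subrr expR0.
have Vlam : 1 - lam <= expR (- lam) := expR_ge1Dx _.
(* From [e^lam (1 - lam) <= 1] and [lam <= 1/2]: [e^lam - 1 <= lam / (1 - lam) <= 2 lam = delta]. *)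
have E2 : expR lam - 1 <= delta by rewrite /lam in EV Vlam *; nra.
have g0 := gamma_gt0; have k0 := kappa_gt0.
have dk0 : 0 <= d%:R / kap by rewrite divr_ge0 // ltW.
have dg : d%:R <= d%:R / g by rewrite ler_pdivlMr // ler_piMr // gamma_le1.
have n0 := sum_x_ge0; have d0 : 0 <= d%:R :> R by [].
have H1 : (n + d%:R / g) * (expR lam - 1) <= (n + d%:R / g) * delta.
  by rewrite ler_wpM2l //; lra.
(* The terms [delta n] cancel, and [12 d / gamma] pays for [3 d / gamma], for [2 d <= 2 d / gamma]
   and for [delta d / gamma]. What remains exceeds [2 d / gamma], which times [lam = delta / 2] is
   the target exponent. *)
have H2 : 2 * (d%:R / g) <= b - level lam.
  rewrite /b -[12 * d%:R / g]mulrA -[2 * d%:R / kap]mulrA.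
  have : d%:R / g * delta <= d%:R / g by rewrite ler_piMr //; lra.
  lra.
have := ler_wpM2l (ltW lam0) H2.
rewrite -[delta * d%:R / g]mulrA /lam; lra.
Qed.

End RandomizedExchange.

Theorem theorem2p4 (R : realType) :
  exists C : R, 0 < C /\
  forall (d m : nat) (u : 'I_m -> 'cV[R]_d) (k p : nat) (eps : R)
         (x : 'I_m -> R) (tau : nat) (delta : R),
    (0 < d)%N -> (d <= k)%N -> (1 <= p)%N -> 0 < eps < 1 ->
    optimal u p k x ->
    (#|fractional x| <= d ^ 2 + 1)%N ->
    0 <= delta <= 1 ->
    1 - expR (- (C * (delta * d%:R / Num.min (gamma p eps) (kappa p eps))))
    <= Pr u p eps x (fun s : traj m tau =>
         produced u p eps x s && small_lambda_min u x s ==>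
         (#|at_time s tau|%:R <=
            (1 + delta) * (\sum_(i < m) x i)
            + (12 * d%:R / gamma p eps + 2 * d%:R / kappa p eps))).
Proof.
exists 1; split=> // d m u k p eps x tau delta d0 _ p1 eps01 [[_ x01 pdX] _] frac delta01.
rewrite mul1r (min_idPl (gamma_le_kappa p1 eps01)).
have -> := Pr_live u p eps x tau
  (fun S => #|S|%:R <= (1 + delta) * (\sum_(i < m) x i)
            + (12 * d%:R / gamma p eps + 2 * d%:R / kappa p eps)).
by rewrite lerD2l lerN2 tail_bound.
Qed.
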